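(* Let $\{\mathbf{x}_k\}_{k\ge1}$ be an infinite sequence of iterates generated by the algorithm ACSA, let $\mathbf{x}_*$ be the critical point to which it converges, and let $\theta\in[0,1)$ be an exponent for which the Kurdyka–Łojasiewicz inequality holds at $\mathbf{x}_*$. Then the following estimations hold. (i) If $\theta\in(0,\tfrac12]$, there exist $\gamma>0$ and $\varrho\in(0,1)$ such that $$\|\mathbf{x}_k-\mathbf{x}_*\|\le\gamma\varrho^k .$$ (ii) If $\theta\in(\tfrac12,1)$, there exists $\gamma>0$ such that $$\|\mathbf{x}_k-\mathbf{x}_*\|\le\gamma k^{-\frac{1-\theta}{2\theta-1}} .$$
   Context: Let $m$ be an even positive integer and $n$ a positive integer. For a real symmetric $m$th order $n$-dimensional tensor $\mathcal{A}=(a_{i_1,\ldots,i_m})$ (entries invariant under permutation of indices) and $\mathbf{x}\in\mathbb{R}^n$, let $\mathcal{A}\mathbf{x}^m=\sum_{i_1,\ldots,i_m=1}^n a_{i_1,\ldots,i_m}x_{i_1}\cdots x_{i_m}$, and let $\mathcal{A}\mathbf{x}^{m-1}\in\mathbb{R}^n$ be the vector with $i$th entry $\sum_{i_2,\ldots,i_m=1}^n a_{i,i_2,\ldots,i_m}x_{i_2}\cdots x_{i_m}$. $\mathcal{H}$ is an $m$th order $n$-dimensional Hankel tensor, i.e. $h_{i_1,\ldots,i_m}=v_{i_1+\cdots+i_m-m}$ for a real generating vector $\mathbf{v}=(v_0,\ldots,v_{m(n-1)})^{\top}$. $\mathcal{B}$ is a symmetric $m$th order $n$-dimensional tensor that is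 positive definite: $\mathcal{B}\mathbf{x}^m>0$ for all $\mathbf{x}\neq 0$. The norm $\|\cdot\|$ is Euclidean and $\mathbb{S}_{n-1}=\{\mathbf{x}\in\mathbb{R}^n:\mathbf{x}^{\top}\mathbf{x}=1\}$. Put $f(\mathbf{x})=\dfrac{\mathcal{H}\mathbf{x}^m}{\mathcal{B}\mathbf{x}^m}$ for $\mathbf{x}\ne0$, whose gradient is $\mathbf{g}(\mathbf{x})=\nabla f(\mathbf{x})=\dfrac{m}{\mathcal{B}\mathbf{x}^m}\Big(\mathcal{H}\mathbf{x}^{m-1}-\dfrac{\mathcal{H}\mathbf{x}^m}{\mathcal{B}\mathbf{x}^m}\mathcal{B}\mathbf{x}^{m-1}\Big)$. A critical point is a point where $\mathbf{g}$ vanishes. Algorithm ACSA. Parameters: $\eta\in(0,\tfrac12]$, $\beta\in(0,1)$, $\alpha_{\max}\ge1$; start from $\mathbf{x}_1\in\mathbb{S}_{n-1}$ and $\bar\alpha_1=1$. For $k=1,2,\ldots$: with $$\mathbf{x}_{k+1}(\alpha)=\frac{1-\alpha^2\|\mathbf{g}(\mathbf{x}_k)\|^2}{1+\alpha^2\|\mathbf{g}(\mathbf{x}_k)\|^2}\mathbf{x}_k-\frac{2\alpha}{1+\alpha^2\|\mathbf{g}(\mathbf{x}_k)\|^2}\mathbf{g}(\mathbf{x}_k),$$ choose the smallest nonnegative integer $\ell$ such that $\alpha_k=\beta^{\ell}\bar\alpha_k$ satisfies $f(\mathbf{x}_{k+1}(\alpha_k))\le f(\mathbf{x}_k)-\eta\alpha_k\|\mathbf{g}(\mathbf{x}_k)\|^2$;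 set $\mathbf{x}_{k+1}=\mathbf{x}_{k+1}(\alpha_k)$; choose the next initial step size $\bar\alpha_{k+1}\in(0,\alpha_{\max}]$ as $\bar\alpha_{k+1}=\min\{\alpha_{\max},\|\mathbf{x}_{k+1}-\mathbf{x}_k\|/\|\mathbf{g}(\mathbf{x}_{k+1})-\mathbf{g}(\mathbf{x}_k)\|\}$ (equal to $\alpha_{\max}$ if the denominator is zero). The algorithm generates an infinite sequence when $\mathbf{g}(\mathbf{x}_k)\ne0$ for all $k$; such a sequence converges to a critical point. Kurdyka–Łojasiewicz (KL) inequality at a critical point $\mathbf{x}_*$ with exponent $\theta\in[0,1)$: there are a neighborhood $\mathscr{U}$ of $\mathbf{x}_*$ and a constant $C_1>0$ such that $\dfrac{|f(\mathbf{x})-f(\mathbf{x}_* )|^{\theta}}{\|\mathbf{g}(\mathbf{x})\|}\le C_1$ for all $\mathbf{x}\in\mathscr{U}$, read as $|f(\mathbf{x})-f(\mathbf{x}_* )|^{\theta}\le C_1\|\mathbf{g}(\mathbf{x})\|$, with the convention $0^0=1$. (It is a known theorem that such $\mathscr{U},\theta,C_1$ exist at every critical point.) *)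

(* Defs.v *)
From mathcomp Require Export all_boot all_order all_algebra.
From mathcomp Require Export all_classical all_reals all_analysis.
Export numFieldNormedType.Exports.
Export Order.TTheory GRing.Theory Num.Theory.

Set Implicit Arguments.
Unset Strict Implicit.
Unset Printing Implicit Defensive.

Local Open Scope classical_set_scope.
Local Open Scope ring_scope.

(* The library norm on 'rV[R]_n is the sup norm, hence [enorm] below; the
   topology of 'rV[R]_n is nevertheless the usual one. *)
Definition dotp (R : realType) (n : nat) (u v : 'rV[R]_n) : R :=
  (u *m v^T) 0 0.

Definition enorm (R : realType) (n : nat) (u : 'rV[R]_n) : R :=
  Num.sqrt (dotp u u).

Definition usphere (R : realType) (n : nat) : set 'rV[R]_n :=
  [set u | dotp u u = 1].
Arguments usphere : clear implicits.

(* Indices are 0-based: they range over {0, ..., n-1}. *)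
Definition tensor (R : realType) (m n : nat) := m.-tuple 'I_n -> R.

Definition sym_tensor (R : realType) (m n : nat) (A : tensor R m n) : Prop :=
  forall s t : m.-tuple 'I_n, perm_eq s t -> A s = A t.

Definition tform (R : realType) (m n : nat) (A : tensor R m n)
    (x : 'rV[R]_n) : R :=
  \sum_(t : m.-tuple 'I_n) A t * \prod_(j <- t) x 0 j.

Definition posdef_tensor (R : realType) (m n : nat) (A : tensor R m n) : Prop :=
  forall x : 'rV[R]_n, x != 0 -> 0 < tform A x.

(* With 0-based indices the subscript i_1 + ... + i_m - m of the generating
   vector is the plain sum of the indices; it is at most m(n-1), so [inord] never
   falls back to its default value when n > 0. *)
Definition hankel (R : realType) (m n : nat) (v : 'rV[R]_((m * n.-1).+1)) :
    tensor R m n :=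
  fun t => v 0 (inord (\sum_(j <- t) (j : nat))%N).

(* Meaningful for x != 0 only; at 0 it takes the junk value 0 when m > 0. *)
Definition quotient_fun (R : realType) (m n : nat) (H B : tensor R m n)
    (x : 'rV[R]_n) : R :=
  tform H x / tform B x.

Definition gradient (R : realType) (n : nat) (f : 'rV[R]_n -> R)
    (x : 'rV[R]_n) : 'rV[R]_n :=
  \row_(i < n) 'D_(delta_mx 0 i) f x.

Definition critical_point (R : realType) (n : nat) (f : 'rV[R]_n -> R)
    (x : 'rV[R]_n) : Prop :=
  gradient f x = 0.

Definition acsa_curve (R : realType) (n : nat) (f : 'rV[R]_n -> R)
    (x : 'rV[R]_n) (a : R) : 'rV[R]_n :=
  let g := gradient f x in
  let s := a ^+ 2 * enorm g ^+ 2 in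
  ((1 - s) / (1 + s)) *: x - ((2 * a) / (1 + s)) *: g.

Definition acsa_accept (R : realType) (n : nat) (f : 'rV[R]_n -> R) (eta : R)
    (x : 'rV[R]_n) (a : R) : Prop :=
  f (acsa_curve f x a) <= f x - eta * a * enorm (gradient f x) ^+ 2.

Definition next_init_step (R : realType) (n : nat) (f : 'rV[R]_n -> R)
    (amax : R) (x y : 'rV[R]_n) : R :=
  let d := enorm (gradient f y - gradient f x) in
  if d == 0 then amax else Num.min amax (enorm (y - x) / d).

(* Sequences start at index 1; the values at index 0 are irrelevant.
   [abar k] is the initial step size and [alpha k] the accepted one. *)
Record acsa_run (R : realType) (n : nat) (f : 'rV[R]_n -> R)
    (eta beta amax : R) (x : nat -> 'rV[R]_n) (alpha abar : nat -> R) : Prop :=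
  AcsaRun {
    acsa_start : usphere R n (x 1%N);
    acsa_init : abar 1%N = 1;
    acsa_search : forall k : nat, (0 < k)%N ->
      exists l : nat,
        [/\ alpha k = beta ^+ l * abar k,
            acsa_accept f eta (x k) (alpha k) &
            forall j : nat, (j < l)%N ->
              ~ acsa_accept f eta (x k) (beta ^+ j * abar k)];
    acsa_next : forall k : nat, (0 < k)%N ->
      x k.+1 = acsa_curve f (x k) (alpha k);
    acsa_reinit : forall k : nat, (0 < k)%N ->
      abar k.+1 = next_init_step f amax (x k) (x k.+1) }.

Definition acsa_infinite (R : realType) (n : nat) (f : 'rV[R]_n -> R)
    (eta beta amax : R) (x : nat -> 'rV[R]_n) : Prop :=
  (exists alpha abar : nat -> R, acsa_run f eta beta amax x alpha abar) /\
  (forall k : nat, (0 < k)%N -> gradient f (x k) != 0).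

(* [powR] satisfies 0 `^ 0 = 1. *)
Definition KL_inequality (R : realType) (n : nat) (f : 'rV[R]_n -> R)
    (xs : 'rV[R]_n) (theta : R) : Prop :=
  exists2 C1 : R, 0 < C1 &
    \forall z \near xs, `|f z - f xs| `^ theta <= C1 * enorm (gradient f z).

(* Main.v *)
(** The quotient f = Hx^m / Bx^m has a locally Lipschitz gradient away from 0 and,
    being constant along rays, satisfies g(x).x = 0; hence the iterates stay on the
    unit sphere and |x_(k+1) - x_k| <= 2 alpha_k |g(x_k)|. The second-order Taylor
    bound along the search curve keeps the accepted step sizes alpha_k bounded away
    from 0. Let xs be the limit and D_k = f(x_k) - f(xs) > 0. Sufficient decrease,
    the KL inequality and concavity of t |-> t^(1-theta) give
      |x_(k+1) - x_k| <= M (D_k^(1-theta) - D_(k+1)^(1-theta)),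
    so |x_k - xs| <= M D_k^(1-theta) by telescoping, while
      D_(k+1) <= D_k - c D_k^(2 theta)
    gives geometric decay of D_k when theta <= 1/2, and, when p = 2 theta - 1 > 0,
    D_(k+1)^(-p) >= D_k^(-p) + p c, i.e. D_k = O(k^(-1/p)). *)

Require Import Defs.
From mathcomp Require Import ring lra.

Set Implicit Arguments.
Unset Strict Implicit.
Unset Printing Implicit Defensive.

Local Open Scope classical_set_scope.
Local Open Scope ring_scope.

(** * Euclidean and sup norms *)

Section EuclideanNorm.
Context {R : realType} {n : nat}.
Implicit Types u v w : 'rV[R]_n.

Lemma dotpE u v : dotp u v = \sum_i u 0 i * v 0 i.
Proof. by rewrite /dotp mxE; apply: eq_bigr => i _; rewrite mxE. Qed.

Lemma dotpC u v : dotp u v = dotp v u.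
Proof. by rewrite !dotpE; apply: eq_bigr => i _; rewrite mulrC. Qed.

Lemma dotpDl u v w : dotp (u + v) w = dotp u w + dotp v w.
Proof. by rewrite /dotp mulmxDl mxE. Qed.

Lemma dotpZl a u v : dotp (a *: u) v = a * dotp u v.
Proof. by rewrite /dotp -scalemxAl mxE. Qed.

Lemma dotpNl u v : dotp (- u) v = - dotp u v.
Proof. by rewrite -scaleN1r dotpZl mulN1r. Qed.

Lemma dotpBl u v w : dotp (u - v) w = dotp u w - dotp v w.
Proof. by rewrite dotpDl dotpNl. Qed.

Lemma dotpZr a u v : dotp u (a *: v) = a * dotp u v.
Proof. by rewrite dotpC dotpZl (dotpC u). Qed.

Lemma dotpBr u v w : dotp u (v - w) = dotp u v - dotp u w.
Proof. by rewrite dotpC dotpBl !(dotpC u). Qed.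

Lemma dotp_deltal i u : dotp (delta_mx 0 i) u = u 0 i.
Proof.
rewrite dotpE (bigD1 i) //= big1 => [|j ji]; rewrite mxE /=.
  by rewrite !eqxx mul1r addr0.
by rewrite (negPf ji) ?andbF mul0r.
Qed.

Lemma dotp_ge0 u : 0 <= dotp u u.
Proof. by rewrite dotpE; apply: sumr_ge0 => i _; rewrite -expr2 sqr_ge0. Qed.

Lemma enorm_ge0 u : 0 <= enorm u.
Proof. exact: sqrtr_ge0. Qed.

Lemma sqr_enorm u : enorm u ^+ 2 = dotp u u.
Proof. by rewrite sqr_sqrtr ?dotp_ge0. Qed.

Lemma normr_coord_le u i : `|u 0 i| <= `|u|.
Proof.
rewrite [leRHS]mx_normrE.
exact: (le_bigmax_cond _ (fun ij : 'I_1 * 'I_n => `|u ij.1 ij.2|) (j := (0, i))).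
Qed.

Lemma normr_le_coord u a : 0 <= a -> (forall i, `|u 0 i| <= a) -> `|u| <= a.
Proof.
move=> a0 ua; rewrite [leLHS]mx_normrE; apply/bigmax_leP; split => // -[i j] _.
by rewrite /= ord1.
Qed.

Lemma normr_le_enorm u : `|u| <= enorm u.
Proof.
apply: normr_le_coord => [|i]; first exact: enorm_ge0.
rewrite -(@ler_pXn2r _ 2) ?nnegrE ?enorm_ge0// sqr_enorm dotpE (bigD1 i) //=.
rewrite real_normK ?num_real// expr2 lerDl.
by apply: sumr_ge0 => j _; rewrite -expr2 sqr_ge0.
Qed.

Lemma dotp_le_norm u v : `|dotp u v| <= n%:R * (`|u| * `|v|).
Proof.
rewrite dotpE (le_trans (ler_norm_sum _ _ _))//.
rewrite -[n in n%:R]card_ord mulr_natl -sumr_const; apply: ler_sum => i _.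
by rewrite normrM ler_pM ?normr_coord_le.
Qed.

Lemma enorm_le_norm u : enorm u <= n%:R * `|u|.
Proof.
rewrite -(@ler_pXn2r _ 2) ?nnegrE ?enorm_ge0 ?mulr_ge0// sqr_enorm.
have /= := dotp_le_norm u u; rewrite ger0_norm ?dotp_ge0// => /le_trans; apply.
rewrite exprMn -!expr2 ler_wpM2r ?sqr_ge0// -natrX ler_nat.
by case: n => // k; rewrite expnS leq_pmulr ?expn_gt0.
Qed.

End EuclideanNorm.

(** * Functions with Lipschitz gradient *)

Section QuadraticTaylor.
Context {R : realType} {n : nat}.
Implicit Types (U : set 'rV[R]_n) (F : 'rV[R]_n -> R).

(* The clauses are stated for an arbitrary [G] so that the class is closed under the
   ring operations and inversion without any calculus; [G] is identified with
   [gradient F] only afterwards, from the Taylor clause. *)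
Definition C11_bound U F (G : 'rV[R]_n -> 'rV[R]_n) (L : R) : Prop :=
  forall y z, U y -> U z ->
  [/\ `|F y| <= L, `|G y| <= L, `|F z - F y| <= L * `|z - y|,
      `|G z - G y| <= L * `|z - y| &
      `|F z - F y - dotp (G y) (z - y)| <= L * `|z - y| ^+ 2].

Definition C11_on U F : Prop := exists G L, C11_bound U F G L.

Lemma C11_bound_le U F G L L' :
  L <= L' -> C11_bound U F G L -> C11_bound U F G L'.
Proof.
move=> LL' FG y z Uy Uz; have [h1 h2 h3 h4 h5] := FG y z Uy Uz.
split; first exact: le_trans LL'.
- exact: le_trans LL'.
- by rewrite (le_trans h3)// ler_wpM2r.
- by rewrite (le_trans h4)// ler_wpM2r.
- by rewrite (le_trans h5)// ler_wpM2r// sqr_ge0.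
Qed.

Lemma C11_bound_ge0 U F G L y : C11_bound U F G L -> U y -> 0 <= L.
Proof. by move=> FG Uy; have [+ _ _ _ _] := FG _ _ Uy Uy; exact: le_trans. Qed.

Lemma C11_onS U V F : V `<=` U -> C11_on U F -> C11_on V F.
Proof.
by move=> VU [G [L FG]]; exists G, L => y z /VU Uy /VU Uz; exact: FG.
Qed.

Lemma C11_cst U (c : R) : C11_on U (fun=> c).
Proof.
exists (fun=> 0), `|c| => y z _ _.
rewrite !subrr -(scale0r (0 : 'rV[R]_n)) dotpZl mul0r subrr scale0r !normr0.
by split => //; rewrite mulr_ge0// sqr_ge0.
Qed.

Lemma C11_coord p i : C11_on (ball p (1 : R)) (fun x => x 0 i).
Proof.
(* [|p| + 1] bounds the coordinate on the ball; being at least 1, it also serves for the constant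
   gradient. The Taylor remainder is 0. *)
exists (fun=> delta_mx 0 i), (`|p| + 1) => y z By Bz.
have yp : `|y| <= `|p| + 1.
  move: By; rewrite -ball_normE /= => pyl.
  by rewrite -[y](subrK p) (le_trans (ler_normD _ _))// addrC lerD2l distrC ltW.
have p1 : 1 <= `|p| + 1 by rewrite lerDr.
have p0 : 0 <= `|p| + 1 by rewrite (le_trans _ p1).
rewrite dotp_deltal subrr normr0 !mxE subrr normr0; split.
- exact: le_trans (normr_coord_le _ _) yp.
- apply: (le_trans _ p1); apply: normr_le_coord => // j; rewrite mxE.
  by case: andP => _; rewrite ?normr1 ?normr0.
- have := normr_coord_le (z - y) i; rewrite !mxE => /le_trans; apply.
  by rewrite ler_peMl.
- by rewrite mulr_ge0.
- by rewrite mulr_ge0// sqr_ge0.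
Qed.

Lemma C11_add U F1 F2 : C11_on U F1 -> C11_on U F2 ->
  C11_on U (fun x => F1 x + F2 x).
Proof.
move=> [G1 [L1 FG1]] [G2 [L2 FG2]].
exists (fun x => G1 x + G2 x), (L1 + L2) => y z Uy Uz.
have [a1 b1 c1 d1 e1] := FG1 _ _ Uy Uz; have [a2 b2 c2 d2 e2] := FG2 _ _ Uy Uz.
rewrite !mulrDl dotpDl opprD; split.
- by rewrite (le_trans (ler_normD _ _))// lerD.
- by rewrite (le_trans (ler_normD _ _))// lerD.
- by rewrite addrACA (le_trans (ler_normD _ _))// lerD.
- by rewrite opprD addrACA (le_trans (ler_normD _ _))// lerD.
- set d1' := dotp _ _ in e1 *; set d2' := dotp _ _ in e2 *.
  have -> : F1 z + F2 z + (- F1 y - F2 y) - (d1' + d2') =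
    F1 z - F1 y - d1' + (F2 z - F2 y - d2') by ring.
  by rewrite (le_trans (ler_normD _ _))// lerD.
Qed.

Lemma C11_mul U F1 F2 : C11_on U F1 -> C11_on U F2 ->
  C11_on U (fun x => F1 x * F2 x).
Proof.
move=> [G1 [L1 FG1]] [G2 [L2 FG2]].
(* The factor 4 comes from the increment of the gradient, which splits into four terms; the other
   clauses need at most three. *)
exists (fun x => F1 x *: G2 x + F2 x *: G1 x), (4 * (L1 * L2)) => y z Uy Uz.
have [a1 b1 c1 d1 e1] := FG1 _ _ Uy Uz; have [a2 b2 c2 d2 e2] := FG2 _ _ Uy Uz.
have [az1 bz1 _ _ _] := FG1 _ _ Uz Uy; have [az2 bz2 _ _ _] := FG2 _ _ Uz Uy.
have bnd (a b A B : R) : `|a| <= A -> `|b| <= B -> `|a * b| <= A * B.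
  by move=> aA bB; rewrite normrM ler_pM.
have bndZ (a : R) (b : 'rV[R]_n) A B : `|a| <= A -> `|b| <= B -> `|a *: b| <= A * B.
  by move=> aA bB; rewrite normrZ ler_pM.
have L1_ge0 : 0 <= L1 by exact: le_trans a1.
have L2_ge0 : 0 <= L2 by exact: le_trans a2.
have LL : 0 <= L1 * L2 by exact: mulr_ge0.
have d0 : 0 <= `|z - y| by [].
have q0 : 0 <= L1 * L2 * `|z - y| by rewrite mulr_ge0.
have r0 : 0 <= L1 * L2 * `|z - y| ^+ 2 by rewrite mulr_ge0// sqr_ge0.
split.
- by apply: le_trans (bnd _ _ _ _ a1 a2) _; lra.
- apply: le_trans (ler_normD _ _) _.
  have := bndZ _ _ _ _ a1 b2; have := bndZ _ _ _ _ a2 b1; lra.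
- have -> : F1 z * F2 z - F1 y * F2 y =
    F1 z * (F2 z - F2 y) + (F1 z - F1 y) * F2 y by ring.
  apply: le_trans (ler_normD _ _) _.
  have := bnd _ _ _ _ az1 c2; have := bnd _ _ _ _ c1 a2; lra.
- have -> : F1 z *: G2 z + F2 z *: G1 z - (F1 y *: G2 y + F2 y *: G1 y) =
    (F1 z *: (G2 z - G2 y) + (F1 z - F1 y) *: G2 y) +
    (F2 z *: (G1 z - G1 y) + (F2 z - F2 y) *: G1 y).
    by apply/rowP => j; rewrite !mxE; ring.
  apply: le_trans (ler_normD _ _) _.
  have h1 := ler_normD (F1 z *: (G2 z - G2 y)) ((F1 z - F1 y) *: G2 y).
  have h2 := ler_normD (F2 z *: (G1 z - G1 y)) ((F2 z - F2 y) *: G1 y).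
  have := bndZ _ _ _ _ az1 d2; have := bndZ _ _ _ _ c1 b2.
  have := bndZ _ _ _ _ az2 d1; have := bndZ _ _ _ _ c2 b1; lra.
- rewrite dotpDl !dotpZl.
  (* The remainder of a product consists of the two weighted remainders and the product of the
     increments, which is quadratic by the Lipschitz clauses for the values. *)
  have -> : F1 z * F2 z - F1 y * F2 y -
      (F1 y * dotp (G2 y) (z - y) + F2 y * dotp (G1 y) (z - y)) =
    F1 y * (F2 z - F2 y - dotp (G2 y) (z - y)) +
    F2 y * (F1 z - F1 y - dotp (G1 y) (z - y)) +
    (F1 z - F1 y) * (F2 z - F2 y) by ring.
  apply: le_trans (ler_normD _ _) _.
  have h1 := ler_normD (F1 y * (F2 z - F2 y - dotp (G2 y) (z - y)))
    (F2 y * (F1 z - F1 y - dotp (G1 y) (z - y))).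
  have := bnd _ _ _ _ a1 e2; have := bnd _ _ _ _ a2 e1.
  have := bnd _ _ _ _ c1 c2; rewrite expr2 in r0 *; lra.
Qed.

Lemma C11_inv U F (c : R) : 0 < c -> (forall y, U y -> c <= F y) ->
  C11_on U F -> C11_on U (fun x => (F x)^-1).
Proof.
move=> c0 cF [G [L FG]]; pose K := c^-1.
(* K bounds the inverse, K^2 L its gradient and its increments, and K^2 L + 2 K^3 L^2 the increments
   of the gradient, as for the second derivative -F''/F^2 + 2 F'^2/F^3. *)
exists (fun x => - (F x)^-2 *: G x),
  (K + K ^+ 2 * L + 2 * K ^+ 3 * L ^+ 2) => y z Uy Uz.
have [a1 b1 c1 d1 e1] := FG _ _ Uy Uz.
have K0 : 0 < K by rewrite invr_gt0.
have inv_bnd w : U w -> 0 < F w /\ `|(F w)^-1| <= K.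
  move=> Uw; have Fw := lt_le_trans c0 (cF _ Uw); split => //.
  by rewrite normfV gtr0_norm// lef_pV2 ?posrE// cF.
have [Fy Jy] := inv_bnd _ Uy; have [Fz Jz] := inv_bnd _ Uz.
have Fy0 := lt0r_neq0 Fy; have Fz0 := lt0r_neq0 Fz.
have bnd (a b A B : R) : `|a| <= A -> `|b| <= B -> `|a * b| <= A * B.
  by move=> aA bB; rewrite normrM ler_pM.
have bndZ (a : R) (b : 'rV[R]_n) A B : `|a| <= A -> `|b| <= B -> `|a *: b| <= A * B.
  by move=> aA bB; rewrite normrZ ler_pM.
have L_ge0 : 0 <= L by exact: le_trans a1.
have d0 : 0 <= `|z - y| by [].
have T2 : 0 <= K ^+ 2 * L by rewrite mulr_ge0// sqr_ge0.
have T3 : 0 <= 2 * K ^+ 3 * L ^+ 2.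
  by rewrite mulr_ge0 ?sqr_ge0// mulr_ge0// exprn_ge0// ltW.
have Jyy : `|(F y)^-2| <= K ^+ 2 by rewrite -exprVn expr2 [leRHS]expr2 bnd.
have Jzz : `|(F z)^-2| <= K ^+ 2 by rewrite -exprVn expr2 [leRHS]expr2 bnd.
have dJ : `|(F z)^-1 - (F y)^-1| <= K ^+ 2 * L * `|z - y|.
  have -> : (F z)^-1 - (F y)^-1 = - ((F y)^-1 * (F z)^-1 * (F z - F y)).
    by field; rewrite Fy0 Fz0.
  by rewrite normrN -mulrA -[leRHS]mulrA expr2 -!mulrA !bnd.
split.
- lra.
- apply: le_trans (bndZ _ _ (K ^+ 2) L _ b1) _; first by rewrite normrN.
  lra.
- apply: (le_trans dJ); rewrite ler_wpM2r//; lra.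
- have -> : - (F z)^-2 *: G z - - (F y)^-2 *: G y =
      - (F z)^-2 *: (G z - G y) +
      - (((F z)^-1 - (F y)^-1) * ((F z)^-1 + (F y)^-1)) *: G y.
    by apply/rowP => j; rewrite !mxE; field; rewrite Fy0 Fz0.
  apply: le_trans (ler_normD _ _) _.
  have h1 : `|- (F z)^-2 *: (G z - G y)| <= K ^+ 2 * (L * `|z - y|).
    by apply: bndZ => //; rewrite normrN.
  have h2 : `|- (((F z)^-1 - (F y)^-1) * ((F z)^-1 + (F y)^-1)) *: G y| <=
      K ^+ 2 * L * `|z - y| * (K + K) * L.
    apply: bndZ => //; rewrite normrN; apply: bnd => //.
    by apply: le_trans (ler_normD _ _) _; rewrite lerD.
  have : 0 <= K * `|z - y| by rewrite mulr_ge0// ltW.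
  move: h1 h2; rewrite !exprS expr0 => *; lra.
- rewrite dotpZl.
  have -> : (F z)^-1 - (F y)^-1 - - (F y)^-2 * dotp (G y) (z - y) =
      (F y)^-2 * (F z)^-1 * ((F z - F y) * (F z - F y)) +
      - ((F y)^-2 * (F z - F y - dotp (G y) (z - y))).
    by field; rewrite Fy0 Fz0.
  apply: le_trans (ler_normD _ _) _; rewrite normrN.
  have h1 := bnd _ _ _ _ (bnd _ _ _ _ Jyy Jz) (bnd _ _ _ _ c1 c1).
  have h2 := bnd _ _ _ _ Jyy e1.
  have : 0 <= K * `|z - y| ^+ 2 by rewrite mulr_ge0// ?sqr_ge0// ltW.
  have : 0 <= K ^+ 3 * L ^+ 2 * `|z - y| ^+ 2.
    by rewrite !(mulr_ge0, exprn_ge0)// ltW.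
  move: h1 h2; rewrite !exprS expr0 => *; lra.
Qed.

Lemma C11_sum U (I : Type) (r : seq I) (F : I -> 'rV[R]_n -> R) :
  (forall i, C11_on U (F i)) -> C11_on U (fun x => \sum_(i <- r) F i x).
Proof.
move=> UF; elim: r => [|i r IHr].
  by under eq_fun do rewrite big_nil; exact: C11_cst.
by under eq_fun do rewrite big_cons; exact: C11_add.
Qed.

Lemma C11_prod U (I : Type) (r : seq I) (F : I -> 'rV[R]_n -> R) :
  (forall i, C11_on U (F i)) -> C11_on U (fun x => \prod_(i <- r) F i x).
Proof.
move=> UF; elim: r => [|i r IHr].
  by under eq_fun do rewrite big_nil; exact: C11_cst.
by under eq_fun do rewrite big_cons; exact: C11_mul.
Qed.

Lemma C11_tform m (A : tensor R m n) p : C11_on (ball p (1 : R)) (tform A).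
Proof.
apply: C11_sum => t; apply: C11_mul; first exact: C11_cst.
by apply: C11_prod => i; exact: C11_coord.
Qed.

End QuadraticTaylor.

(** * Identification of the gradient from the Taylor clause *)

Section Gradient.
Context {R : realType} {n : nat}.
Implicit Types (U : set 'rV[R]_n) (F : 'rV[R]_n -> R).

(** Along a coordinate direction [v], dividing the Taylor clause by [h] leaves an error of at most L
    |h| |v|^2, so the difference quotients converge to the coordinates of [G y]. *)
Lemma C11_bound_gradient U F G L y :
  C11_bound U F G L -> nbhs y U -> gradient F y = G y.
Proof.
move=> FG yU; have Uy : U y := nbhs_singleton yU.
have L0 := C11_bound_ge0 FG Uy.
apply/rowP => i; rewrite mxE -(dotp_deltal i) dotpC.
set v := delta_mx 0 i; apply/cvg_lim => //.
apply/cvgrPdist_le => e e0.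
have [d /= d0 dU] : nbhs (0 : R) (fun h : R => U (h *: v + y)).
  have : (fun h : R => h *: v + y) @ (0 : R) --> 0 *: v + y.
    by apply: cvgD; [apply: cvgZr_tmp; exact: cvg_id|exact: cvg_cst].
  by rewrite scale0r add0r => /(_ _ yU).
pose M := L * `|v| ^+ 2 + 1.
have M0 : 0 < M by rewrite ltr_wpDl// mulr_ge0// sqr_ge0.
exists (Num.min d (e / M)) => /=; first by rewrite lt_min d0 divr_gt0.
move=> h /=; rewrite sub0r normrN lt_min => /andP[hd he] h0.
have Uh : U (h *: v + y) by apply: dU => /=; rewrite sub0r normrN.
have [_ _ _ _] := FG _ _ Uy Uh; rewrite addrK dotpZr normrZ => T.
have -> : dotp (G y) v - h^-1 *: (F (h *: v + y) - F y) =
    - (h^-1 * (F (h *: v + y) - F y - h * dotp (G y) v)).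
  by rewrite /GRing.scale/=; field.
rewrite normrN normrM normfV mulrC ler_pdivrMr ?normr_gt0//.
apply: (le_trans T); rewrite ltr_pdivlMr// in he.
have : 0 <= `|h| by [].
have hM : `|h| * (L * `|v| ^+ 2) <= e.
  by apply: le_trans (ltW he); rewrite ler_wpM2l// lerDl.
move=> /(ler_wpM2r) /(_ _ _ hM); rewrite exprMn; lra.
Qed.

End Gradient.

(** * Quotients of forms away from the origin *)

Section HomogeneousQuotient.
Context {R : realType} {m n : nat}.
Implicit Types A B : tensor R m n.

Lemma tformZ A (c : R) x : tform A (c *: x) = c ^+ m * tform A x.
Proof.
rewrite /tform mulr_sumr; apply: eq_bigr => t _.
rewrite mulrCA; congr (_ * _).
under eq_bigr do rewrite mxE.
by rewrite big_split /= big_const_seq count_predT size_tuple iter_mulr_1.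
Qed.

Lemma quotient_funZ A B (c : R) x :
  c != 0 -> quotient_fun A B (c *: x) = quotient_fun A B x.
Proof.
by move=> c0; rewrite /quotient_fun !tformZ -mulf_div divff ?mul1r// expf_neq0.
Qed.

Variables (A B : tensor R m n) (B_pd : posdef_tensor B).
Let f := quotient_fun A B.

(** On a small ball [tform B] stays above half of its positive value at [p], so the rules for
    products and inverses apply. Openness of the ball then lets [gradient f] replace the field they
    produce. *)
Lemma quotient_C11 p : p != 0 ->
  exists L d : R, 0 < d /\ C11_bound (ball p d) f (gradient f) L.
Proof.
move=> p0; have Bp : 0 < tform B p by exact: B_pd.
have [G [L BG]] := C11_tform B p.
have L0 := C11_bound_ge0 BG (ballxx p ltr01).
pose d := Num.min 1 (tform B p / 2 / (L + 1)).
have d0 : 0 < d by rewrite lt_min ltr01 !divr_gt0// ltr_wpDl.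
have dsub : ball p d `<=` ball p (1 : R) by apply: le_ball; rewrite ge_min lexx.
have Bge y : ball p d y -> tform B p / 2 <= tform B y.
  move=> py; have [_ _ + _ _] := BG _ _ (ballxx _ ltr01) (dsub _ py).
  move: py; rewrite -ball_normE /= distrC lt_min => /andP[_].
  rewrite ltr_pdivlMr ?ltr_wpDl// => py.
  rewrite ler_norml => /andP[+ _].
  have := normr_ge0 (y - p); nra.
have [G' [L' fG]] : C11_on (ball p d) f.
  apply: C11_mul.
    by apply: C11_onS (C11_tform A p); exact: dsub.
  apply: (@C11_inv _ _ _ _ (tform B p / 2)) => //; first by rewrite divr_gt0.
  by apply: C11_onS (C11_tform B p); exact: dsub.
exists L', d; split => // y z py pz.
have yd w : ball p d w -> gradient f w = G' w.
  move=> pw; apply: C11_bound_gradient fG _.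
  by apply: open_nbhs_nbhs; split => //; exact: ball_open.
by rewrite !yd//; exact: fG.
Qed.

(* Taylor's bound between [x] and [(1 + t) *: x], where [f] takes the same value,
   gives [|g.x| <= L t |x|^2] for all small [t > 0]. *)
Lemma dotp_gradient_quotient x : x != 0 -> dotp (gradient f x) x = 0.
Proof.
move=> x0; have [L [d [d0 fG]]] := quotient_C11 x0.
have xx := ballxx x d0.
have L0 := C11_bound_ge0 fG xx.
apply/eqP; rewrite -normr_eq0 eq_le normr_ge0 andbT.
apply/ler_addgt0Pl => e e0; rewrite addr0.
have X0 : 0 < `|x| by rewrite normr_gt0.
pose M := L * `|x| ^+ 2 + 1.
have M0 : 0 < M by rewrite ltr_wpDl// mulr_ge0// sqr_ge0.
(* The bound with [d] keeps [(1 + t) *: x] in the ball; the one with [M] brings L t |x|^2 below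
   [e]. *)
pose t := Num.min (Num.min 1 (d / 2 / `|x|)) (e / M).
have t0 : 0 < t by rewrite !lt_min ltr01 !divr_gt0.
have td : t * `|x| <= d / 2.
  by rewrite -ler_pdivlMr// !ge_min lexx !orbT.
have te : t * M <= e by rewrite -ler_pdivlMr// ge_min lexx orbT.
have Uy : ball x d ((1 + t) *: x).
  rewrite -ball_normE /= scalerDl scale1r opprD addNKr normrN normrZ gtr0_norm//.
  lra.
have [_ _ _ _] := fG _ _ xx Uy.
rewrite /f quotient_funZ ?lt0r_neq0 ?addr_gt0// -/f.
rewrite subrr scalerDl scale1r addrAC subrr !add0r dotpZr normrN normrM.
rewrite normrZ !(gtr0_norm t0) exprMn.
move=> h; rewrite -(ler_pM2l t0).
have := ler_wpM2l (ltW t0) te.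
by move: h; rewrite /M; have := mulr_gt0 t0 t0; lra.
Qed.

End HomogeneousQuotient.

(** * Rates from the Kurdyka-Lojasiewicz inequality *)

Section Powers.
Context {R : realType}.
Implicit Types a b c p r s : R.

Lemma ln_le_subr1 r : 0 < r -> ln r <= r - 1.
Proof.
by move=> r0; rewrite -{1}[r](subrKC 1) le_ln1Dx// ltrBrDl subrr.
Qed.

(* With [a := 1 - s + s r], the tangent bounds [ln (r/a) <= r/a - 1] and
   [ln (1/a) <= 1/a - 1], weighted by [s] and [1 - s], add up to [s ln r <= ln a]. *)
Lemma powR_le_affine r s : 0 < r -> 0 <= s -> s <= 1 ->
  r `^ s <= 1 - s + s * r.
Proof.
move=> r0 s0 s1; set a := 1 - s + s * r.
have a0 : 0 < a.
  rewrite /a; have [->|s_neq1] := eqVneq s 1; first by rewrite subrr add0r mul1r.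
  by rewrite ltr_wpDr ?subr_gt0 ?lt_neqAle ?s_neq1// mulr_ge0// ltW.
rewrite -ler_ln ?posrE ?powR_gt0// ln_powR.
have h1 := ln_le_subr1 (divr_gt0 r0 a0); rewrite ln_div ?posrE// in h1.
have h2 : ln a^-1 <= a^-1 - 1 by rewrite ln_le_subr1// invr_gt0.
rewrite lnV ?posrE// in h2.
have e : s * (r / a - 1) + (1 - s) * (a^-1 - 1) = 0.
  by rewrite /a; field; exact: lt0r_neq0.
have s1' : 0 <= 1 - s by rewrite subr_ge0.
have := ler_wpM2l s0 h1; have := ler_wpM2l s1' h2; lra.
Qed.

(** This is the tangent inequality a^s - b^s >= s a^(s-1) (a - b) of a concave power, cleared of the
    negative exponent: take r = b/a in [powR_le_affine] and multiply by [a]. *)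
Lemma powR_sub_ge a b s : 0 < a -> 0 < b -> 0 <= s -> s <= 1 ->
  s * (a - b) <= a `^ (1 - s) * (a `^ s - b `^ s).
Proof.
move=> a0 b0 s0 s1.
have r0 : 0 < b / a by rewrite divr_gt0.
have h := powR_le_affine r0 s0 s1.
have eb : b `^ s = a `^ s * (b / a) `^ s.
  by rewrite -powRM ?ltW// mulrCA divff ?mulr1// lt0r_neq0.
have ea : a `^ (1 - s) * a `^ s = a.
  by rewrite -powRD ?subrK ?powRr1 ?ltW// lt0r_neq0 ?implybT.
rewrite eb [leRHS]mulrBr mulrA ea.
have := ler_wpM2l (ltW a0) h.
have -> : a * (1 - s + s * (b / a)) = a * (1 - s) + s * b.
  by field; rewrite lt0r_neq0.
lra.
Qed.

(** Two tangent bounds in a row: r^(-p) = exp(-p ln r) >= 1 - p ln r, and ln r <= r - 1. *)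
Lemma powRN_ge_affine r p : 0 < r -> 0 <= p -> 1 + p * (1 - r) <= r `^ (- p).
Proof.
move=> r0 p0; rewrite /powR gt_eqF//; apply: le_trans (expR_ge1Dx _).
by rewrite lerD2l mulNr -mulrN ler_wpM2l// lerNr opprB ln_le_subr1.
Qed.

End Powers.

(** * Decay rates of scalar recursions *)

Section DecreaseRates.
Context {R : realType}.
Implicit Types D : nat -> R.

Lemma linear_decrease_rate D (c : R) (K : nat) : 0 < c ->
  (forall k, (K <= k)%N -> 0 < D k) ->
  (forall k, (K <= k)%N -> D k.+1 <= D k - c * D k) ->
  exists C q : R, [/\ 0 < C, 0 < q, q < 1 &
    forall k, (K <= k)%N -> D k <= C * q ^+ k].
Proof.
(* Positivity of both [D K] and its successor, which is at most (1 - c) D_K, forces c < 1. *)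
move=> c0 D0 dec; have q0 : 0 < 1 - c.
  by have := dec _ (leqnn K); have := D0 _ (leqnn K); have := D0 _ (leqnSn K); nra.
exists (D K / (1 - c) ^+ K), (1 - c); split => //.
- by rewrite divr_gt0 ?exprn_gt0 ?D0.
- by rewrite ltrBlDr ltrDl.
move=> k /subnK <-; elim: (k - K)%N => [|j IH].
  by rewrite divfK// expf_neq0// lt0r_neq0.
have := dec _ (leq_addl j K); rewrite addSn exprS => /le_trans; apply.
rewrite mulrCA -[leLHS](_ : (1 - c) * D (j + K)%N = _); last by ring.
by rewrite ler_wpM2l// ltW.
Qed.

(** The power -p linearizes the recursion. For r = D_(k+1)/D_k one has 1 - r >= c D_k^p, and
    D_k^(-p) r^(-p) >= D_k^(-p) (1 + p (1 - r)), so every step adds at least p c. *)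
Lemma power_decrease_rate D (c p : R) (K : nat) : 0 < c -> 0 < p ->
  (forall k, (K <= k)%N -> 0 < D k) ->
  (forall k, (K <= k)%N -> D k.+1 <= D k - c * D k `^ (1 + p)) ->
  forall k, (K <= k)%N -> p * c * (k - K)%:R <= D k `^ (- p).
Proof.
move=> c0 p0 D0 dec k Kk; rewrite -[in D k](subnK Kk).
elim: (k - K)%N => [|j IH]; first by rewrite mulr0 powR_ge0.
have := dec _ (leq_addl j K); rewrite addSn.
set d := D (j + K)%N in IH *; set d' := D _.+1 => h.
have d0 : 0 < d by apply: D0; exact: leq_addl.
have d'0 : 0 < d' by apply: D0; rewrite leqW// leq_addl.
have r0 : 0 < d' / d by rewrite divr_gt0.
have -> : d' `^ (- p) = d `^ (- p) * (d' / d) `^ (- p).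
  by rewrite -powRM ?ltW// mulrCA divff ?mulr1// lt0r_neq0.
have dp : 0 < d `^ (- p) by rewrite powR_gt0.
have := ler_wpM2l (ltW dp) (powRN_ge_affine r0 (ltW p0)).
apply: le_trans; rewrite -natr1 [leLHS]mulrDr [leRHS]mulrDr !mulr1 lerD//.
have e : d `^ (- p) * (d `^ (1 + p) / d) = 1.
  rewrite mulrA -powRD; last by rewrite lt0r_neq0 ?implybT.
  by rewrite addrC addrK powRr1 ?ltW// divff// lt0r_neq0.
have hc : c * (d `^ (1 + p) / d) <= 1 - d' / d.
  by rewrite mulrA ler_pdivrMr// mulrBl mul1r divfK ?lt0r_neq0//; lra.
have pc : p * c = d `^ (- p) * p * (c * (d `^ (1 + p) / d)).
  by rewrite -[LHS]mulr1 -[X in _ * X]e; ring.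
by rewrite [leRHS]mulrA pc ler_wpM2l// mulr_ge0// ltW.
Qed.

Lemma eventually_le_all (a b : nat -> R) (C : R) (K : nat) :
  (forall k, (0 < k)%N -> 0 < b k) ->
  (forall k, (K <= k)%N -> a k <= C * b k) ->
  exists g : R, 0 < g /\ forall k, (0 < k)%N -> a k <= g * b k.
Proof.
(* The sum dominates each of the finitely many early ratios. Absolute values keep every term
   nonnegative, even at index 0, where nothing is known about [b]. *)
move=> b0 aC; pose S := \sum_(i < K) `|a i / b i|.
have S0 : 0 <= S by exact: sumr_ge0.
exists (`|C| + 1 + S); split.
  by rewrite ltr_wpDr// ltr_wpDl.
move=> k k0; have [Kk|kK] := leqP K k.
  apply: (le_trans (aC _ Kk)); rewrite ler_pM2r ?b0//.
  by have := ler_norm C; lra.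
rewrite -ler_pdivrMr ?b0//.
have : `|a k / b k| <= S.
  by rewrite /S (bigD1 (Ordinal kK)) //= lerDl sumr_ge0.
have := ler_norm (a k / b k); have := normr_ge0 C; lra.
Qed.

End DecreaseRates.

(** * Abstract descent sequences under the KL inequality *)

Section KLDescent.
Context {R : realType} {V : normedModType R}.
(** [D] models the gap to the limit value and [G] the gradient norm. Of the two decrease hypotheses,
    [dec1] drives the recursion on [D], while [dec2] trades one factor [G k] for the step length and
    controls distances. *)
Variables (x : nat -> V) (xs : V) (D G : nat -> R) (theta C c1 c2 : R) (K : nat).
Hypotheses (theta_ge0 : 0 <= theta) (theta_lt1 : theta < 1).
Hypotheses (C_gt0 : 0 < C) (c1_gt0 : 0 < c1) (c2_gt0 : 0 < c2).
Hypotheses (x_cvg : x @ \oo --> xs).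
Hypothesis D_gt0 : forall k, (K <= k)%N -> 0 < D k.
Hypothesis D_cvg : D @ \oo --> (0 : R).
Hypothesis G_gt0 : forall k, (K <= k)%N -> 0 < G k.
Hypothesis KL : forall k, (K <= k)%N -> D k `^ theta <= C * G k.
Hypothesis dec1 : forall k, (K <= k)%N -> D k.+1 <= D k - c1 * G k ^+ 2.
Hypothesis dec2 :
  forall k, (K <= k)%N -> D k.+1 <= D k - c2 * (G k * `|x k.+1 - x k|).

Let s := 1 - theta.
Let s_gt0 : 0 < s. Proof. by rewrite subr_gt0. Qed.
Let s_le1 : s <= 1. Proof. by rewrite gerBl. Qed.

(** By [dec2], concavity and KL in turn, s c2 G_k |x_(k+1) - x_k| <= s (D_k - D_(k+1)) <= D_k^theta
    (D_k^s - D_(k+1)^s) <= C G_k (D_k^s - D_(k+1)^s); then G_k > 0 cancels. *)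
Lemma KL_step_le k : (K <= k)%N ->
  `|x k.+1 - x k| <= C / (s * c2) * (D k `^ s - D k.+1 `^ s).
Proof.
move=> Kk; have G0 := G_gt0 Kk.
have sc : 0 < s * c2 by exact: mulr_gt0.
rewrite mulrAC ler_pdivlMr// -(ler_pM2r G0).
have h := powR_sub_ge (D_gt0 Kk) (D_gt0 (leqW Kk)) (ltW s_gt0) s_le1.
have sK : 1 - s = theta by rewrite /s subKr.
rewrite sK in h.
have DD : D k.+1 <= D k.
  apply: (le_trans (dec2 Kk)); rewrite gerBl.
  by rewrite !mulr_ge0// ltW.
have DDs : 0 <= D k `^ s - D k.+1 `^ s.
  by rewrite subr_ge0 ge0_ler_powR ?nnegrE// ltW// D_gt0// leqW.
have h2 := ler_wpM2r DDs (KL Kk).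
have h3 : s * (c2 * (G k * `|x k.+1 - x k|)) <= s * (D k - D k.+1).
  by rewrite ler_pM2l// lerBrDr addrC -lerBrDr; exact: dec2.
lra.
Qed.

(** The step bounds telescope up to index j + k; the subtracted power is nonnegative and is dropped
    before j tends to infinity. *)
Lemma KL_dist_le k : (K <= k)%N -> `|x k - xs| <= C / (s * c2) * D k `^ s.
Proof.
move=> Kk; set M := C / _.
have M0 : 0 < M by rewrite divr_gt0// mulr_gt0.
have part j : `|x k - x (j + k)%N| <= M * (D k `^ s - D (j + k)%N `^ s).
  elim: j => [|j IH]; first by rewrite !subrr mulr0 normr0.
  have := KL_step_le (leq_trans Kk (leq_addl j k)); rewrite -/M => h.
  rewrite addSn; have := ler_normD (x k - x (j + k)%N) (x (j + k)%N - x (j + k).+1).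
  rewrite addrA subrK [in X in _ <= _ + X]distrC; lra.
have : (fun j => `|x k - x (j + k)%N|) @ \oo --> `|x k - xs|.
  apply: cvg_norm; apply: cvgB; first exact: cvg_cst.
  by rewrite (cvg_shiftn k x (nbhs xs)).
move/cvgr_to_le; apply; near=> j; apply: (le_trans (part j)).
by rewrite ler_pM2l// gerBl powR_ge0.
Unshelve. all: by end_near. Qed.

Let c3 := c1 / C ^+ 2.
Let c3_gt0 : 0 < c3. Proof. by rewrite divr_gt0// exprn_gt0. Qed.

Lemma KL_value_decrease k : (K <= k)%N -> D k.+1 <= D k - c3 * D k `^ (2 * theta).
Proof.
move=> Kk; apply: (le_trans (dec1 Kk)); rewrite lerD2l lerN2.
rewrite mulrAC ler_pdivrMr ?exprn_gt0// -mulrA ler_pM2l//.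
rewrite mulrC powRrM powR_mulrn ?powR_ge0// -exprMn mulrC.
by rewrite ler_pXn2r ?nnegrE ?powR_ge0 ?mulr_ge0 ?KL// ltW// G_gt0.
Qed.

Lemma KL_linear_rate : theta <= 1 / 2 ->
  exists (M q : R) (N : nat), [/\ 0 < q, q < 1 &
    forall k, (N <= k)%N -> `|x k - xs| <= M * q ^+ k].
Proof.
move=> th2.
have [N0 _ N0D] : \forall k \near \oo, D k <= 1 by exact: cvgr_le D_cvg _ ltr01.
pose N := maxn N0 K.
(* Once D_k <= 1, the exponent 2 theta <= 1 gives D_k^(2 theta) >= D_k, which makes the recursion
   linear. *)
have dec k : (N <= k)%N -> D k.+1 <= D k - c3 * D k.
  rewrite geq_max => /andP[N0k Kk]; apply: (le_trans (KL_value_decrease Kk)).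
  have Dk01 : 0 < D k <= 1 by rewrite D_gt0 ?N0D.
  have t1 : 2 * theta <= 1 by lra.
  have := ger_powR Dk01 t1; rewrite powRr1 ?(ltW (D_gt0 _))// => DD.
  by rewrite lerD2l lerN2 ler_pM2l.
have D0 k : (N <= k)%N -> 0 < D k.
  by rewrite geq_max => /andP[_]; exact: D_gt0.
have [A [q [A0 q0 q1 Dq]]] := linear_decrease_rate c3_gt0 D0 dec.
exists (C / (s * c2) * A `^ s), (q `^ s), N; split; first exact: powR_gt0.
  have := gt0_ltr_powR s_gt0 (x := q) (y := 1); rewrite powR1.
  by apply; rewrite ?nnegrE ?ltW.
move=> k Nk; have Kk : (K <= k)%N by apply: leq_trans Nk; rewrite leq_maxr.
apply: (le_trans (KL_dist_le Kk)); rewrite -[leRHS]mulrA ler_pM2l; last first.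
  by rewrite divr_gt0// mulr_gt0.
rewrite -powR_mulrn ?powR_ge0// -powRrM (mulrC s) powRrM powR_mulrn ?(ltW q0)//.
have qk : 0 <= q ^+ k by rewrite exprn_ge0// ltW.
rewrite -powRM ?(ltW A0)//.
by rewrite ge0_ler_powR ?nnegrE ?Dq ?mulr_ge0// ltW// D0.
Qed.

Lemma KL_power_rate : 1 / 2 < theta ->
  exists (M : R) (N : nat), forall k, (N <= k)%N ->
    `|x k - xs| <= M * k%:R `^ (- (s / (2 * theta - 1))).
Proof.
move=> th2; set p := 2 * theta - 1; have p0 : 0 < p by rewrite /p; lra.
have dec k : (K <= k)%N -> D k.+1 <= D k - c3 * D k `^ (1 + p).
  by rewrite /p subrKC; exact: KL_value_decrease.
have rate := power_decrease_rate c3_gt0 p0 D_gt0 dec.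
(* For k >= 2K one has k - K >= k/2; this is the origin of the factor 1/2 and of the threshold
   below, whose successor also makes [k] positive. *)
pose b := p * c3 / 2; have b0 : 0 < b by rewrite divr_gt0// mulr_gt0.
exists (C / (s * c2) * b `^ (- (s / p))), (K + K).+1 => k Nk.
have Kk : (K <= k)%N by apply: leq_trans Nk; rewrite -addSn leq_addl.
have k0 : (0 < k)%N by exact: leq_trans Nk.
apply: (le_trans (KL_dist_le Kk)); rewrite -[leRHS]mulrA ler_pM2l; last first.
  by rewrite divr_gt0// mulr_gt0.
rewrite -powRM ?(ltW b0)//.
have bk : b * k%:R <= D k `^ (- p).
  apply: le_trans (rate _ Kk); rewrite /b natrB//.
  have : (K%:R + K%:R : R) <= k%:R by rewrite -natrD ler_nat ltnW.
  have := mulr_gt0 p0 c3_gt0; nra.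
have bk0 : 0 < b * k%:R by rewrite mulr_gt0// ltr0n.
(* The negative exponent -s/p turns the lower bound [bk] into an upper bound on D_k^s. *)
have -> : D k `^ s = (D k `^ (- p)) `^ (- (s / p)).
  by rewrite -powRrM; congr (_ `^ _); field; exact: lt0r_neq0.
rewrite !(powRN _ (s / p)) lef_pV2 ?posrE ?powR_gt0 ?D_gt0//.
by rewrite ge0_ler_powR ?nnegrE ?powR_ge0 ?divr_ge0// ltW.
Qed.

End KLDescent.

(** * The iterates of ACSA *)

Lemma cvg_lipschitz_ball {R : realType} {V W : normedModType R} (h : V -> W)
    (L d : R) (p : V) (x : nat -> V) : 0 < d ->
  (forall y z, ball p d y -> ball p d z -> `|h z - h y| <= L * `|z - y|) ->
  x @ \oo --> p -> h (x k) @[k --> \oo] --> h p.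
Proof.
move=> d0 hL xp; have Lc : 0 < `|L| + 1 by rewrite ltr_wpDl.
apply/cvgrPdist_le => e e0; near=> k.
have xk : ball p d (x k).
  by near: k; apply: xp; exact: nbhsx_ballx.
apply: (le_trans (hL _ _ xk (ballxx _ d0))).
have h1 : `|p - x k| <= e / (`|L| + 1).
  near: k; move/cvgrPdist_le : xp; apply; exact: divr_gt0.
rewrite ler_pdivlMr// in h1; apply: le_trans h1; rewrite mulrC ler_wpM2l//.
by rewrite (le_trans (ler_norm L))// lerDl.
Unshelve. all: by end_near. Qed.

(** * Geometry of the search curve *)

Section Curve.
Context {R : realType} {n : nat}.
Implicit Types (f : 'rV[R]_n -> R) (x u w : 'rV[R]_n).

Lemma dotp_orthogonal_sub u w (p q : R) : dotp w u = 0 ->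
  dotp (p *: u - q *: w) (p *: u - q *: w) =
  p ^+ 2 * dotp u u + q ^+ 2 * dotp w w.
Proof.
move=> wu; rewrite !(dotpBl, dotpBr, dotpZl, dotpZr) (dotpC u w) wu; ring.
Qed.

Variables (f : 'rV[R]_n -> R) (x : 'rV[R]_n) (a : R).
Let g := gradient f x.
Let s := a ^+ 2 * enorm g ^+ 2.
Let y := acsa_curve f x a.
Hypotheses (gx : dotp g x = 0) (xx : dotp x x = 1).

Let s_ge0 : 0 <= s. Proof. by rewrite mulr_ge0// sqr_ge0. Qed.
Let s1_gt0 : 0 < 1 + s. Proof. by rewrite ltr_wpDr. Qed.

Let scaled_gradient_sq :
  (2 * a / (1 + s)) ^+ 2 * enorm g ^+ 2 = 4 * s / (1 + s) ^+ 2.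
Proof. by rewrite expr_div_n mulrAC; congr (_ / _); rewrite /s; ring. Qed.

(** As [g] is orthogonal to the unit vector [x], this is Pythagoras together with (1 - s)^2 + 4 s =
    (1 + s)^2. *)
Lemma dotp_acsa_curve : dotp y y = 1.
Proof.
rewrite /y /acsa_curve -/g -/s dotp_orthogonal_sub// xx -sqr_enorm.
rewrite scaled_gradient_sq; field; exact: lt0r_neq0.
Qed.

Let curve_subE : y - x = (- 2 * s / (1 + s)) *: x - (2 * a / (1 + s)) *: g.
Proof.
rewrite /y /acsa_curve -/g -/s addrAC -{2}[x]scale1r -scalerBl.
by congr (_ *: _ - _); field; exact: lt0r_neq0.
Qed.

Lemma sqr_enorm_acsa_curve_sub : enorm (y - x) ^+ 2 = 4 * s / (1 + s).
Proof.
rewrite sqr_enorm curve_subE dotp_orthogonal_sub// xx -sqr_enorm.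
rewrite scaled_gradient_sq; field; exact: lt0r_neq0.
Qed.

Lemma enorm_acsa_curve_sub_le : 0 <= a -> enorm (y - x) <= 2 * (a * enorm g).
Proof.
move=> a0; have t0 : 0 <= 2 * (a * enorm g) by rewrite !mulr_ge0// enorm_ge0.
rewrite -(@ler_pXn2r _ 2) ?nnegrE ?enorm_ge0//.
rewrite sqr_enorm_acsa_curve_sub ler_pdivrMr//.
have -> : (2 * (a * enorm g)) ^+ 2 = 4 * s by rewrite /s; ring.
by have := mulr_ge0 s_ge0 s_ge0; have := s_ge0; lra.
Qed.

Lemma dotp_gradient_acsa_curve_sub :
  dotp g (y - x) = - (2 * a / (1 + s) * enorm g ^+ 2).
Proof.
by rewrite curve_subE dotpBr !dotpZr gx mulr0 sub0r sqr_enorm.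
Qed.

(** Taylor's bound and the exact length of the displacement give a decrease of at least a |g|^2 (2 -
    4 L a)/(1 + s). The smallness conditions make the last ratio at least 1/2, hence at least
    [eta]. *)
Lemma acsa_accept_small U (L eta : R) : C11_bound U f (gradient f) L ->
  U x -> U y -> 0 <= a -> 4 * L * a <= 1 -> s <= 1 -> eta <= 1 / 2 ->
  acsa_accept f eta x a.
Proof.
move=> fg Ux Uy a0 La s1 eta2; rewrite /acsa_accept -/y -/g.
have L0 := C11_bound_ge0 fg Ux.
have [_ _ _ _ /(le_trans (ler_norm _))] := fg _ _ Ux Uy.
rewrite -/g dotp_gradient_acsa_curve_sub => T.
have N : L * `|y - x| ^+ 2 <= L * (4 * s / (1 + s)).
  rewrite ler_wpM2l// -sqr_enorm_acsa_curve_sub.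
  by rewrite ler_pXn2r ?nnegrE ?normr_ge0 ?enorm_ge0// normr_le_enorm.
have E : 2 * a / (1 + s) * enorm g ^+ 2 - L * (4 * s / (1 + s)) =
    a * enorm g ^+ 2 * ((2 - 4 * L * a) / (1 + s)).
  have -> : L * (4 * s / (1 + s)) = a * enorm g ^+ 2 * (4 * L * a / (1 + s)).
    by rewrite !mulrA {1}/s; congr (_ / _); ring.
  by field; exact: lt0r_neq0.
have q : eta <= (2 - 4 * L * a) / (1 + s).
  by rewrite (le_trans eta2)// ler_pdivlMr//; lra.
have h : 0 <= a * enorm g ^+ 2 by rewrite mulr_ge0// sqr_ge0.
have := ler_wpM2l h q; lra.
Qed.

End Curve.

(** * Invariants, descent and step sizes along a run *)

Section Run.
Context {R : realType} {n : nat}.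
Variables (f : 'rV[R]_n -> R) (eta beta amax : R).
Hypotheses (eta_gt0 : 0 < eta) (eta_le : eta <= 1 / 2).
Hypotheses (beta_gt0 : 0 < beta) (beta_lt1 : beta < 1) (amax_ge1 : 1 <= amax).
Variables (x : nat -> 'rV[R]_n) (xs : 'rV[R]_n) (alpha abar : nat -> R).
Hypothesis run : acsa_run f eta beta amax x alpha abar.
Hypothesis euler : forall y, y != 0 -> dotp (gradient f y) y = 0.

Let dotp1_neq0 (y : 'rV[R]_n) : dotp y y = 1 -> y != 0.
Proof.
move=> yy; apply/eqP => y0; move: yy; rewrite y0 -(scale0r 0) dotpZl mul0r.
by move/eqP; rewrite eq_sym oner_eq0.
Qed.

Lemma acsa_run_sphere k : (0 < k)%N -> dotp (x k) (x k) = 1.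
Proof.
case: k => // k _; elim: k => [|k IH]; first exact: (acsa_start run).
by rewrite (acsa_next run)// dotp_acsa_curve// euler// dotp1_neq0.
Qed.

Lemma acsa_run_gradient_orth k : (0 < k)%N -> dotp (gradient f (x k)) (x k) = 0.
Proof. by move=> /acsa_run_sphere /dotp1_neq0 /euler. Qed.

Lemma acsa_run_abar k : (0 < k)%N -> 0 <= abar k <= amax.
Proof.
case: k => // -[_|k _]; first by rewrite (acsa_init run) ler01.
have amax0 : 0 <= amax by exact: le_trans amax_ge1.
rewrite (acsa_reinit run)// /next_init_step; case: ifP => _.
  by rewrite amax0 lexx.
by rewrite ge_min lexx le_min amax0 divr_ge0 ?enorm_ge0.
Qed.

Lemma acsa_run_alpha_ge0 k : (0 < k)%N -> 0 <= alpha k.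
Proof.
move=> k0; have [l [-> _ _]] := acsa_search run k0.
have /andP[a0 _] := acsa_run_abar k0.
by rewrite mulr_ge0// exprn_ge0// ltW.
Qed.

Lemma acsa_run_step_le k : (0 < k)%N ->
  `|x k.+1 - x k| <= 2 * (alpha k * enorm (gradient f (x k))).
Proof.
move=> k0; apply: le_trans (normr_le_enorm _) _; rewrite (acsa_next run)//.
by rewrite enorm_acsa_curve_sub_le ?acsa_run_alpha_ge0//
  ?acsa_run_gradient_orth ?acsa_run_sphere.
Qed.

Lemma acsa_run_decrease k : (0 < k)%N ->
  f (x k.+1) <= f (x k) - eta * alpha k * enorm (gradient f (x k)) ^+ 2.
Proof.
by move=> k0; have [l [_ + _]] := acsa_search run k0; rewrite (acsa_next run).
Qed.

Lemma acsa_run_nonincreasing k j : (0 < k)%N -> f (x (j + k)%N) <= f (x k).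
Proof.
move=> k0; elim: j => // j; apply: le_trans; rewrite addSn.
have jk0 : (0 < j + k)%N by rewrite addn_gt0 k0 orbT.
apply: le_trans (acsa_run_decrease jk0) _; rewrite gerBl.
by rewrite mulr_ge0 ?sqr_ge0// mulr_ge0 ?acsa_run_alpha_ge0// ltW.
Qed.

Hypothesis x_cvg : x @ \oo --> xs.

(** On the sphere 1 <= n |x_k| in the sup norm, and this inequality passes to the limit. *)
Lemma acsa_limit_neq0 : xs != 0.
Proof.
rewrite -normr_gt0; have : 1 <= n%:R * `|xs|.
  have : n%:R * `|x k| @[k --> \oo] --> n%:R * `|xs|.
    by apply: cvgMl_tmp; apply: cvg_norm.
  move/cvgr_to_ge; apply; near=> k.
  have k0 : (0 < k)%N by near: k; exact: nbhs_infty_gt.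
  by apply: le_trans (enorm_le_norm _); rewrite /enorm acsa_run_sphere// sqrtr1.
rewrite lt_neqAle normr_ge0 andbT eq_sym => h; apply/eqP => n0.
by move: h; rewrite n0 mulr0 ler10.
Unshelve. all: by end_near. Qed.

Variables (L d : R).
Hypotheses (d_gt0 : 0 < d) (L_gt0 : 0 < L).
Hypothesis fC11 : C11_bound (ball xs d) f (gradient f) L.
Hypothesis xs_crit : critical_point f xs.

Lemma acsa_run_value_cvg : f (x k) @[k --> \oo] --> f xs.
Proof.
apply: (cvg_lipschitz_ball d_gt0 _ x_cvg) => y z By Bz.
by have [_ _ h _ _] := fC11 By Bz; exact: h.
Qed.

Lemma acsa_run_value_ge k : (0 < k)%N -> f xs <= f (x k).
Proof.
move=> k0; have : f (x (j + k)%N) @[j --> \oo] --> f xs.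
  rewrite (cvg_shiftn k (fun j => f (x j)) (nbhs (f xs))).
  exact: acsa_run_value_cvg.
move/cvgr_to_le; apply; near=> j; exact: acsa_run_nonincreasing.
Unshelve. all: by end_near. Qed.

Lemma acsa_run_gradient_near (e : R) : 0 < e ->
  \forall k \near \oo, enorm (gradient f (x k)) <= e.
Proof.
move=> e0.
have gc : gradient f (x k) @[k --> \oo] --> gradient f xs.
  apply: (cvg_lipschitz_ball d_gt0 _ x_cvg) => y z By Bz.
  by have [_ _ _ h _] := fC11 By Bz; exact: h.
rewrite xs_crit in gc.
have n0 : 0 < n%:R + 1 :> R by rewrite ltr_wpDl.
near=> k; apply: (le_trans (enorm_le_norm _)).
have : `|0 - gradient f (x k)| <= e / (n%:R + 1).
  near: k; move/cvgrPdist_le : gc; apply; exact: divr_gt0.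
rewrite sub0r normrN ler_pdivlMr// => h; apply: le_trans h.
by rewrite mulrC ler_wpM2l// lerDl.
Unshelve. all: by end_near. Qed.

(** If the initial step is accepted, it is [amax] or a ratio bounded below through the Lipschitz
    gradient. Otherwise the last rejected trial [a] must violate 4 L a <= 1 by [acsa_accept_small],
    and the accepted step is [beta * a]. *)
Lemma acsa_run_alpha_ge :
  exists amin : R, 0 < amin /\ \forall k \near \oo, amin <= alpha k.
Proof.
have amax0 : 0 < amax by exact: lt_le_trans amax_ge1.
have nL : 0 < (n%:R + 1) * L by rewrite mulr_gt0// ltr_wpDl.
pose amin := Num.min (Num.min 1 ((n%:R + 1) * L)^-1) (beta / (4 * L)).
exists amin; split.
  by rewrite !lt_min ltr01 invr_gt0 nL divr_gt0// mulr_gt0.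
(* A trial point lies within 2 amax |g| of its iterate, so [d / 4] keeps it within d/2 of that
   iterate and hence in the ball; the bound by 1 yields s <= 1. *)
have [N _ HN] : \forall k \near \oo, [/\ (0 < k)%N, `|xs - x k| < d / 2,
    amax * enorm (gradient f (x k)) <= 1 &
    amax * enorm (gradient f (x k)) <= d / 4].
  near=> k; split.
  - by near: k; exact: nbhs_infty_gt.
  - by near: k; move/cvgrPdist_lt : x_cvg; apply; rewrite divr_gt0.
  - rewrite mulrC -ler_pdivlMr//; near: k.
    by apply: acsa_run_gradient_near; rewrite divr_gt0.
  - rewrite mulrC -ler_pdivlMr//; near: k.
    by apply: acsa_run_gradient_near; rewrite !divr_gt0.
(* The initial step at [k.+1] is computed from [x k] as well, so both indices have to be past
   [N]. *)
exists N.+1 => // -[//|k] /= Nk.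
have [k0 xk _ _] := HN _ Nk; have [_ xk1 g1 gd] := HN _ (leqW Nk).
have d2 : d / 2 < d by move: d_gt0; lra.
have Bk : ball xs d (x k) by rewrite -ball_normE /=; exact: lt_trans d2.
have Bk1 : ball xs d (x k.+1) by rewrite -ball_normE /=; exact: lt_trans d2.
have [l [-> _ rej]] := acsa_search run (ltn0Sn k).
have /andP[ab0 abm] := acsa_run_abar (ltn0Sn k).
case: l rej => [_|l rej].
  rewrite expr0 mul1r (acsa_reinit run)// /next_init_step.
  case: ifPn => [_|g0]; first by rewrite !ge_min amax_ge1.
  rewrite le_min !ge_min amax_ge1 /=.
  have gp : 0 < enorm (gradient f (x k.+1) - gradient f (x k)).
    by rewrite lt_neqAle eq_sym g0 enorm_ge0.
  suff -> : ((n%:R + 1) * L)^-1 <= enorm (x k.+1 - x k) /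
      enorm (gradient f (x k.+1) - gradient f (x k)) by rewrite orbT.
  rewrite ler_pdivlMr// ler_pdivrMl//.
  have [_ _ _ gL _] := fC11 Bk Bk1.
  apply: (le_trans (enorm_le_norm _)); rewrite -mulrA ler_pM ?lerDl//.
  apply: (le_trans gL); rewrite ler_pM2l//; exact: normr_le_enorm.
set a := beta ^+ l * abar k.+1.
have a0 : 0 <= a by rewrite mulr_ge0// exprn_ge0// ltW.
have am : a <= amax.
  apply: le_trans abm; rewrite ler_piMl// exprn_ile1//; exact: ltW.
have xx := acsa_run_sphere (ltn0Sn k).
have gx := acsa_run_gradient_orth (ltn0Sn k).
have ag : a * enorm (gradient f (x k.+1)) <= amax * enorm (gradient f (x k.+1)).
  by rewrite ler_wpM2r// enorm_ge0.
have ag0 : 0 <= a * enorm (gradient f (x k.+1)) by rewrite mulr_ge0// enorm_ge0.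
have By : ball xs d (acsa_curve f (x k.+1) a).
  rewrite -ball_normE /= -(subrK (x k.+1) xs) -addrA.
  apply: le_lt_trans (ler_normD _ _) _.
  have := le_trans (normr_le_enorm _) (enorm_acsa_curve_sub_le gx xx a0).
  by rewrite distrC; lra.
rewrite exprS -mulrA -/a /amin ge_min; apply/orP; right.
rewrite ler_pdivrMr ?mulr_gt0// -mulrA ler_peMr ?(ltW beta_gt0)//.
rewrite leNgt; apply/negP => aL; apply: (rej l (ltnSn l)).
apply: (acsa_accept_small gx xx fC11) => //.
- by rewrite mulrC ltW.
- by rewrite -exprMn expr_le1// (le_trans ag).
Unshelve. all: by end_near. Qed.

End Run.

Theorem theorem7 (R : realType) (m n : nat)
    (m_gt0 : (0 < m)%N) (m_even : ~~ odd m) (n_gt0 : (0 < n)%N)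
    (v : 'rV[R]_((m * n.-1).+1)) (B : tensor R m n)
    (B_sym : sym_tensor B) (B_pd : posdef_tensor B)
    (eta beta amax : R)
    (eta_gt0 : 0 < eta) (eta_le : eta <= 1 / 2)
    (beta_gt0 : 0 < beta) (beta_lt1 : beta < 1) (amax_ge1 : 1 <= amax)
    (x : nat -> 'rV[R]_n) (xs : 'rV[R]_n) (theta : R)
    (x_acsa : acsa_infinite (quotient_fun (hankel v) B) eta beta amax x)
    (x_cvg : x @ \oo --> xs)
    (xs_crit : critical_point (quotient_fun (hankel v) B) xs)
    (theta_ge0 : 0 <= theta) (theta_lt1 : theta < 1)
    (xs_KL : KL_inequality (quotient_fun (hankel v) B) xs theta) :
  (0 < theta /\ theta <= 1 / 2 ->
     exists gamma rho : R,
       [/\ 0 < gamma, 0 < rho, rho < 1 &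
           forall k : nat, (0 < k)%N -> enorm (x k - xs) <= gamma * rho ^+ k])
  /\
  (1 / 2 < theta /\ theta < 1 ->
     exists gamma : R,
       0 < gamma /\
       forall k : nat, (0 < k)%N ->
         enorm (x k - xs)
           <= gamma * k%:R `^ (- ((1 - theta) / (2 * theta - 1)))).
Proof.
set f := quotient_fun (hankel v) B in x_acsa xs_crit xs_KL.
have [[alpha [abar run]] g_neq0] := x_acsa.
have euler y : y != 0 -> dotp (gradient f y) y = 0.
  exact: dotp_gradient_quotient.
have xs0 := acsa_limit_neq0 run euler x_cvg.
have [L0 [d [d0 fC0]]] := quotient_C11 (hankel v) B_pd xs0; rewrite -/f in fC0.
pose L := L0 + 1; have L_gt0 : 0 < L.
  by rewrite ltr_wpDl// (C11_bound_ge0 fC0 (ballxx xs d0)).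
have fC : C11_bound (ball xs d) f (gradient f) L.
  by apply: C11_bound_le fC0; rewrite lerDl.
have [amin [amin0 alpha_ge]] := acsa_run_alpha_ge eta_le beta_gt0 beta_lt1 amax_ge1
  run euler x_cvg d0 L_gt0 fC xs_crit.
have [C C0 KL] := xs_KL.
have [K _ HK] : \forall k \near \oo, [/\ (0 < k)%N, amin <= alpha k &
    `|f (x k) - f xs| `^ theta <= C * enorm (gradient f (x k))].
  near=> k; split; near: k; [exact: nbhs_infty_gt|exact: alpha_ge|].
  exact: (x_cvg _ KL).
pose D k := f (x k) - f xs; pose G k := enorm (gradient f (x k)).
have G0 k : (K <= k)%N -> 0 < G k.
  move=> /HK[k0 _ _]; apply: lt_le_trans (normr_le_enorm _).
  by rewrite normr_gt0 g_neq0.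
have fdec k : (K <= k)%N -> D k.+1 <= D k - eta * alpha k * G k ^+ 2.
  by move=> /HK[k0 _ _]; rewrite /D addrAC lerD2r; exact: (acsa_run_decrease run).
(* The next gap is nonnegative and the decrease at [k] is strict because the gradient is nonzero. *)
have D0 k : (K <= k)%N -> 0 < D k.
  move=> Kk; have [k0 ak _] := HK _ Kk.
  have : 0 <= D k.+1.
    rewrite subr_ge0.
    exact: (acsa_run_value_ge eta_gt0 beta_gt0 amax_ge1 run x_cvg d0 fC).
  have : 0 < eta * alpha k * G k ^+ 2.
    by rewrite mulr_gt0 ?exprn_gt0 ?G0// mulr_gt0// (lt_le_trans amin0).
  by have := fdec _ Kk; lra.
have Dcvg : D @ \oo --> (0 : R).
  rewrite -(subrr (f xs)); apply: cvgB; last exact: cvg_cst.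
  exact: (acsa_run_value_cvg x_cvg d0 fC).
have KLk k : (K <= k)%N -> D k `^ theta <= C * G k.
  by move=> Kk; have [_ _] := HK _ Kk; rewrite ger0_norm// ltW// D0.
have c1 : 0 < eta * amin by rewrite mulr_gt0.
have dec1 k : (K <= k)%N -> D k.+1 <= D k - eta * amin * G k ^+ 2.
  move=> Kk; apply: (le_trans (fdec _ Kk)); have [_ ak _] := HK _ Kk.
  by rewrite lerD2l lerN2 ler_wpM2r ?sqr_ge0// ler_pM2l.
(* Since |x_(k+1) - x_k| <= 2 alpha_k G_k, the decrease eta alpha_k G_k^2 is at least (eta/2) G_k
   |x_(k+1) - x_k|. *)
have c2 : 0 < eta / 2 by rewrite divr_gt0.
have dec2 k : (K <= k)%N -> D k.+1 <= D k - eta / 2 * (G k * `|x k.+1 - x k|).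
  move=> Kk; apply: (le_trans (fdec _ Kk)); have [k0 _ _] := HK _ Kk.
  rewrite lerD2l lerN2.
  have := acsa_run_step_le beta_gt0 amax_ge1 run euler k0; rewrite -/(G k) => h.
  have := ler_wpM2l (ltW (mulr_gt0 c2 (G0 _ Kk))) h; lra.
have n0 : 0 < n%:R :> R by rewrite ltr0n.
split.
- move=> [_ th2].
  have [M [q [N [q0 q1 h]]]] := KL_linear_rate theta_ge0 theta_lt1 C0 c1 c2 x_cvg D0
    Dcvg G0 KLk dec1 dec2 th2.
  (* Passing from the sup norm to the Euclidean norm costs a factor [n]; the indices before [N] are
     absorbed into the constant. *)
  have [||g [g0 hg]] := @eventually_le_all _ (fun k => enorm (x k - xs))
    (fun k => q ^+ k) (n%:R * M) N.
  + by move=> k _; exact: exprn_gt0.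
  + move=> k Nk; apply: (le_trans (enorm_le_norm _)).
    by rewrite -mulrA ler_pM2l// h.
  by exists g, q; split.
- move=> [th2 _].
  have [M [N h]] := KL_power_rate theta_ge0 theta_lt1 C0 c1 c2 x_cvg D0
    G0 KLk dec1 dec2 th2.
  apply: (@eventually_le_all _ (fun k => enorm (x k - xs)) _ (n%:R * M) N).
  + by move=> k k0; rewrite powR_gt0// ltr0n.
  + move=> k Nk; apply: (le_trans (enorm_le_norm _)).
    by rewrite -mulrA ler_pM2l// h.
Unshelve. all: by end_near. Qed.
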